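(* Let $\delta_1>0$ be an admissible one-dimensional sum-product exponent, i.e. a constant such that every finite, non-empty set $B\subseteq\mathbb{R}$ satisfies $|B+B|+|B\cdot B|\gtrsim |B|^{1+\delta_1}$. Let $d\in\mathbb{N}$ and let $A\subseteq\mathbb{R}^d$ be a finite, non-empty set. Then \[ |A+A|+|A\cdot A| \gtrsim_d |A|^{1+\delta_1/d}. \]
   Context: For $a=(a_1,\dots,a_d)$, $b=(b_1,\dots,b_d)\in\mathbb{R}^d$, addition and multiplication are coordinatewise: $a+b=(a_1+b_1,\dots,a_d+b_d)$, $a\cdot b=(a_1b_1,\dots,a_db_d)$. For finite sets $A,B$, $A+B=\{a+b: a\in A, b\in B\}$ and $A\cdot B=\{a\cdot b: a\in A,b\in B\}$. Notation: $X\gtrsim Y$ means $|X|\ge C|Y|(\log|A|)^{D}$ for some constants $C>0$ and $D$ (with $A$ the set under consideration); $X\gtrsim_z Y$ means the same with $C$ and $D$ allowed to depend on the parameter $z$. The paper takes $\delta_1$ to be the best known such exponent; by a result of Shakan, $\delta_1=1/3+5/5277$ is admissible. *)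

(* Defs.v *)
From HB Require Import structures.
From mathcomp Require Import all_boot all_order all_algebra finmap.
From mathcomp Require Import all_classical all_reals all_analysis.
From mathcomp Require Import Rstruct.
Set Implicit Arguments. Unset Strict Implicit. Unset Printing Implicit Defensive.
Import Order.TTheory GRing.Theory Num.Theory.
Local Open Scope ring_scope.


Definition RR := Rdefinitions.R.

Definition cmul (d : nat) (a b : 'rV[RR]_d) : 'rV[RR]_d := \row_i (a 0 i * b 0 i).

Definition sumset (d : nat) (A B : {fset 'rV[RR]_d}) : {fset 'rV[RR]_d} :=
  [fset (a + b)%R | a in A, b in B]%fset.
Definition prodset (d : nat) (A B : {fset 'rV[RR]_d}) : {fset 'rV[RR]_d} :=
  [fset (cmul a b) | a in A, b in B]%fset.

Definition sumset1 (A B : {fset RR}) : {fset RR} := [fset (a + b)%R | a in A, b in B]%fset.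
Definition prodset1 (A B : {fset RR}) : {fset RR} := [fset (a * b)%R | a in A, b in B]%fset.

Definition admissible_sp_exponent (delta : RR) : Prop :=
  exists C D : RR, 0 < C /\
    forall B : {fset RR}, B != fset0%fset ->
      C * ((#|` B|%:R) `^ (1 + delta)) * ((ln (#|` B|%:R)) `^ D)
        <= (#|` sumset1 B B| + #|` prodset1 B B|)%:R.

(* Main.v *)
Require Import Defs.
From HB Require Import structures.
From mathcomp Require Import all_boot all_order all_algebra finmap.
From mathcomp Require Import all_classical all_reals all_analysis.
From mathcomp Require Import Rstruct.
From mathcomp Require Import lra ring.
Import Order.TTheory GRing.Theory Num.Theory.
Local Open Scope ring_scope.

(* The coordinate projections are ring morphisms, so if the fibers of A over
   B = p_i(A) all have at least k points and A is cancellative, then A+A and A.A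
   have at least k points over each point of B+B and B.B, whence
   |A+A| + |A.A| >= k (|B+B| + |B.B|), which is at least k |B|^(1+delta1) up to
   logarithms.  Cancellation for products holds after passing to the most
   frequent zero pattern.  Let H = 1 + ln |A|.  For each coordinate in turn, pass
   to the points lying on fibers of a suitable level k, keeping a proportion 1/H;
   this gives k |B_i| >= |A| / O(H^d) for every i.  The final set embeds in the
   product of the B_i and has size at least |A| / O(H^d), so some B_i has size at
   least |A|^(1/d) / O(H), and k |B_i| |B_i|^delta1 is as large as required. *)

(** * Counting along fibers *)

Definition fiber {T U : choiceType} (f : T -> U) (A : {fset T}) (u : U) :
  {fset T} := [fset x in A | f x == u]%fset.

Lemma in_fiber {T U : choiceType} (f : T -> U) (A : {fset T}) (u : U) (x : T) :
  (x \in fiber f A u) = (x \in A) && (f x == u).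
Proof. by rewrite !inE. Qed.

Lemma fiber_sub {T U : choiceType} (f : T -> U) (A : {fset T}) (u : U) :
  (fiber f A u `<=` A)%fset.
Proof. by apply/fsubsetP => x; rewrite !inE => /andP[]. Qed.

Lemma card_sum_fiber {T U : choiceType} (f : T -> U) (A : {fset T}) :
  #|` A| = (\sum_(u <- [fset f x | x in A]%fset) #|` fiber f A u|)%N.
Proof.
rewrite card_fset_sum1 (partition_big_imfset _ f); apply: eq_bigr => u _.
by rewrite card_fset_sum1 /fiber big_fset_condE.
Qed.

Lemma card_ge_fiber {T U : choiceType} {f : T -> U} {A : {fset T}} {k : nat} :
  (forall u, u \in [fset f x | x in A]%fset -> (k <= #|` fiber f A u|)%N) ->
  (k * #|` [fset f x | x in A]%fset| <= #|` A|)%N.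
Proof.
move=> kle; rewrite [leqRHS](card_sum_fiber f A).
apply: (@leq_trans (\sum_(u <- [fset f x | x in A]%fset) k)%N).
  by rewrite big_const_seq count_predT iter_addn_0.
by rewrite big_seq [leqRHS]big_seq; apply: leq_sum => u; apply: kle.
Qed.

Lemma pigeonhole_fiber {T : choiceType} {F : finType} (f : T -> F)
    (A : {fset T}) : A != fset0%fset ->
  exists v, (#|` A| <= #|F| * #|` fiber f A v|)%N.
Proof.
case/fset0Pn => x0 _.
have [v _ maxv] := @arg_maxnP F (f x0) xpredT (fun v => #|` fiber f A v|) isT.
exists v; rewrite (card_sum_fiber f A).
apply: (@leq_trans (\sum_(u <- [fset f x | x in A]%fset) #|` fiber f A v|)%N).
  by apply: leq_sum => u _; apply: maxv.
rewrite big_const_seq count_predT iter_addn_0 mulnC leq_mul2r.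
by rewrite -(card_uniqP (fset_uniq _)) max_card orbT.
Qed.

(** The image under [f] of the set of all [opT a b] is exactly the set of all [opU u v]. Over [f a]
    op [f b], translating the fiber of [f b] by [a] gives points that are distinct by cancellation,
    so each image point has a fiber of size at least [k]. *)
Lemma card_imfset2_ge {T U : choiceType} {opT : T -> T -> T}
    {opU : U -> U -> U} {f : T -> U} {A : {fset T}} {k : nat} :
  {morph f : a b / opT a b >-> opU a b} ->
  (forall a, a \in A -> {in A &, injective (opT a)}) ->
  (forall u, u \in [fset f x | x in A]%fset -> (k <= #|` fiber f A u|)%N) ->
  (k * #|` [fset opU u v |
         u in [fset f x | x in A], v in [fset f x | x in A]]%fset|
    <= #|` [fset opT a b | a in A, b in A]%fset|)%N.
Proof.
move=> fM inj_op kle.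
set AA := [fset opT a b | a in A, b in A]%fset.
set BB := (X in (_ * #|` X| <= _)%N).
have -> : BB = [fset f x | x in AA]%fset.
  apply/fsetP => w; apply/imfset2P/imfsetP => /=.
    move=> [_ /imfsetP[a aA ->] [_ /imfsetP[b bA ->] ->]].
    by exists (opT a b); rewrite ?fM// in_imfset2.
  move=> [_ /imfset2P[a aA [b bA ->]] ->].
  exists (f a); first by rewrite in_imfset.
  by exists (f b); rewrite ?fM// in_imfset.
apply: card_ge_fiber => _ /imfsetP[_ /imfset2P[a aA [b bA ->]] ->].
apply: leq_trans (kle (f b) _) _; first by rewrite in_imfset.
have /(card_in_imfset imfset_key) <- : {in fiber f A (f b) &, injective (opT a)}.
  by move=> x y; rewrite !in_fiber => /andP[xA _] /andP[yA _]; apply: inj_op.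
apply/fsubset_leq_card/fsubsetP => w /imfsetP[x /= xfib ->].
move: xfib; rewrite !inE => /andP[xA /eqP fx].
by rewrite !fM fx eqxx andbT in_imfset2.
Qed.

(** Points of [A] are determined by their projections, so [A] injects into the product of the [d]
    images, each no larger than the largest one. *)
Lemma card_le_exp_proj {T U : choiceType} {d : nat} (p : 'I_d -> T -> U)
    (A : {fset T}) : (0 < d)%N -> A != fset0%fset ->
  {in A &, forall x y, (forall i, p i x = p i y) -> x = y} ->
  exists i, (#|` A| <= #|` [fset p i x | x in A]%fset| ^ d)%N.
Proof.
move=> d0 An0 inj_p; pose B i := [fset p i x | x in A]%fset.
have [i _ maxi] := @arg_maxnP 'I_d (Ordinal d0) xpredT (fun i => #|` B i|) isT.
exists i; rewrite -/(B i).
have : (0 < #|` B i|)%N.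
  have /fset0Pn[x xA] := An0; rewrite cardfs_gt0; apply/fset0Pn.
  by exists (p i x); rewrite in_imfset.
move: maxi; case: #|` B i| => // m maxi _.
(* Each projection is coded by its position in [B j]. All positions are below the maximal size
   [m.+1], so [inord] loses nothing. *)
pose h x : {ffun 'I_d -> 'I_m.+1} := [ffun j => inord (index (p j x) (B j))].
have inj_h : {in A &, injective h}.
  move=> x y xA yA hxy; apply: inj_p => // j.
  have idx z : z \in A -> (index (p j z) (B j) < m.+1)%N.
    move=> zA; apply: leq_trans (maxi j isT).
    by rewrite index_mem in_imfset.
  have := congr1 (fun g : {ffun 'I_d -> 'I_m.+1} => val (g j)) hxy.
  rewrite !ffunE /= !inordK ?idx// => /(congr1 (nth (p j x) (B j))).
  by rewrite !nth_index ?in_imfset.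
rewrite -(card_in_imfset imfset_key inj_h).
rewrite -(card_uniqP (fset_uniq _)).
by apply: leq_trans (max_card _) _; rewrite card_ffun !card_ord.
Qed.

(** * Popular fiber levels *)

Lemma harmonic_sum_le (R : realType) (n : nat) :
  \sum_(1 <= k < n.+2) k%:R^-1 <= 1 + ln n.+1%:R :> R.
Proof.
elim: n => [|n IHn]; first by rewrite big_nat1 ln1 invr1 addr0.
rewrite big_nat_recr//=.
set x : R := n.+2%:R; have x0 : 0 < x by rewrite ltr0n.
have n0 : 0 < n.+1%:R :> R by rewrite ltr0n.
(* With [x = n + 2], this says that the new term [1/x] is at most [ln x - ln (x - 1)], so the bound
   telescopes. *)
have : ln (1 + - x^-1) <= - x^-1.
  by apply: le_ln1Dx; rewrite ltrN2 invf_lt1// /x (_ : 1 = 1%:R)// ltr_nat.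
have -> : 1 + - x^-1 = n.+1%:R / x.
  have -> : n.+1%:R = x - 1 by rewrite /x -[n.+2%:R]natr1 addrK.
  by rewrite mulrBl divff ?gt_eqF// mul1r.
rewrite ln_div ?posrE// => lnx.
apply: le_trans (lerD IHn (lexx _)) _.
by rewrite -addrA lerD2l -lerBrDl -lerN2 opprB.
Qed.

(* Layer cake: |A| is the sum over k >= 1 of the number of fibers with at least
   k points, and a bound M / (k H) on each term would sum to less than |A|. *)
Lemma popular_fibers {R : realType} {T U : choiceType} (f : T -> U)
    (A : {fset T}) : A != fset0%fset ->
  exists (A' : {fset T}) (k : nat),
  [/\ (A' `<=` A)%fset,
    (forall u, u \in [fset f x | x in A']%fset -> (k <= #|` fiber f A' u|)%N) &
    #|` A|%:R <=
      (k * #|` [fset f x | x in A']%fset|)%:R * (1 + ln #|` A|%:R) :> R].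
Proof.
move=> An0; set n := #|` A|; have n0 : (0 < n)%N by rewrite cardfs_gt0.
pose A' k := [fset x in A | (k <= #|` fiber f A (f x)|)%N]%fset.
pose B k := [fset f x | x in A' k]%fset.
pose H : R := 1 + ln n%:R.
have H1 : 1 <= H by rewrite lerDl ln_ge0// ler1n.
have H0 : 0 < H by apply: lt_le_trans H1.
have [[k kH]|noH] := pselect (exists k, n%:R <= (k * #|` B k|)%:R * H).
  exists (A' k), k; split=> //.
    by apply/fsubsetP => x; rewrite !inE => /andP[].
  move=> _ /imfsetP[x /= xA' ->].
  move: xA'; rewrite !inE => /andP[xA kx].
  (* [A' k] is a union of whole fibers of [A], so a fiber that survives has lost no point. *)
  apply: leq_trans (kx) _; apply/fsubset_leq_card/fsubsetP => y.
  rewrite in_fiber => /andP[yA /eqP fy]; rewrite in_fiber fy eqxx andbT.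
  by rewrite !inE yA fy kx.
have BE k : #|` B k| = (\sum_(u <- [fset f x | x in A]%fset)
    (k <= #|` fiber f A u|))%N.
  have -> : B k =
      [fset u in [fset f x | x in A] | (k <= #|` fiber f A u|)%N]%fset.
    apply/fsetP => u; apply/imfsetP/idP => /=.
      move=> [x xA' ->]; move: xA'; rewrite !inE => /andP[xA ->].
      by rewrite in_imfset.
    rewrite !inE => /andP[/imfsetP[x /= xA ->] kx].
    by exists x; rewrite // !inE xA.
  by rewrite card_fset_sum1 -big_fset_condE big_mkcond.
have cardA : n = (\sum_(1 <= k < n.+1) #|` B k|)%N.
  rewrite {1}/n (card_sum_fiber f A).
  under [RHS]eq_bigr do rewrite BE.
  rewrite exchange_big /=; apply: eq_bigr => u _.
  have : (#|` fiber f A u| <= n)%N by exact: fsubset_leq_card (fiber_sub _ _ _).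
  move: #|` fiber f A u| => m mn.
  (* A fiber of size [m] is counted once for each level [1 <= k <= m] and never beyond. *)
  rewrite (@big_cat_nat _ _ _ m.+1)//= [X in (_ + X)%N]big_nat_cond.
  rewrite [X in (_ + X)%N]big1 ?addn0; last first.
    by move=> k /andP[/andP[mk _] _]; rewrite leqNgt mk.
  rewrite big_nat_cond (eq_bigr (fun=> 1%N)) -?big_nat_cond
     ?sum_nat_const_nat ?subn1 ?muln1//.
  by move=> k /andP[/andP[_ km] _]; rewrite -ltnS km.
suff : n%:R < n%:R :> R by rewrite ltxx.
rewrite {1}cardA natr_sum.
have : \sum_(1 <= k < n.+1) #|` B k|%:R
    < \sum_(1 <= k < n.+1) (n%:R / H) * k%:R^-1 :> R.
  apply: ltr_sum_nat => //= k /andP[k1 kn].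
  have : (k * #|` B k|)%:R * H < n%:R.
    by rewrite ltNge; apply/negP => h; apply: noH; exists k.
  have k0 : 0 < k%:R :> R by rewrite ltr0n.
  by rewrite -(ltr_pdivlMr _ _ H0) natrM mulrC -(ltr_pdivlMr _ _ k0).
move/lt_le_trans; apply.
rewrite -mulr_sumr -mulrA ler_piMr// ler_pdivrMl// mulr1.
by move: n0; rewrite /H; case: (n) => // m _; exact: harmonic_sum_le.
Qed.

(** Coordinates are treated one after another, each costing a factor [H]. Later refinements may thin
    the earlier fibers, so the lower bound for [i] is recorded on the intermediate set [Ai] and not
    on the final [A']. *)
Lemma popular_fibers_seq {R : realType} {I : eqType} {T U : choiceType}
    (p : I -> T -> U) (A : {fset T}) (s : seq I) : A != fset0%fset ->
  let H : R := 1 + ln #|` A|%:R in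
  exists A' : {fset T},
  [/\ (A' `<=` A)%fset, #|` A|%:R <= #|` A'|%:R * H ^+ size s &
    forall i, i \in s -> exists (Ai : {fset T}) (k : nat),
    [/\ (A' `<=` Ai)%fset, (Ai `<=` A)%fset,
      (forall u, u \in [fset p i x | x in Ai]%fset ->
        (k <= #|` fiber (p i) Ai u|)%N) &
      #|` A|%:R <= (k * #|` [fset p i x | x in Ai]%fset|)%:R * H ^+ size s]].
Proof.
move=> An0 H; have n0 : (0 < #|` A|)%N by rewrite cardfs_gt0.
have H1 : 1 <= H by rewrite lerDl ln_ge0// ler1n.
have H0 : 0 < H by apply: lt_le_trans H1.
elim: s => [|i s [A1 [sA1 cardA1 IH]]].
  by exists A; rewrite expr0 mulr1.
have A1n0 : A1 != fset0%fset.
  apply: contraTneq cardA1 => ->.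
  by rewrite cardfs0 mul0r -ltNge ltr0n.
have [A2 [k [sA2 kle cardA2]]] := popular_fibers (R := R) (p i) A1 A1n0.
have n1 : (0 < #|` A1|)%N by rewrite cardfs_gt0.
have HA1 : 1 + ln #|` A1|%:R <= H.
  by rewrite lerD2l ler_ln ?posrE ?ltr0n// ler_nat fsubset_leq_card.
have key : #|` A|%:R
    <= (k * #|` [fset p i x | x in A2]%fset|)%:R * H ^+ (size s).+1.
  apply: le_trans cardA1 _; rewrite exprS mulrA ler_pM2r ?exprn_gt0//.
  by apply: le_trans cardA2 _; rewrite ler_wpM2l.
exists A2; split=> /=.
- exact: fsubset_trans sA1.
- apply: le_trans key _; rewrite ler_pM2r ?exprn_gt0// ler_nat.
  exact: card_ge_fiber.
- move=> j; rewrite inE => /orP[/eqP ->|js].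
    by exists A2, k; split=> //; exact: fsubset_trans sA1.
  have [Aj [l [sAj sAjA lle cardAj]]] := IH j js.
  exists Aj, l; split=> //; first exact: fsubset_trans sAj.
  apply: le_trans cardAj _; rewrite ler_wpM2l ?ler0n//.
  by rewrite exprS ler_peMl ?exprn_ge0// ltW.
Qed.

(** * Bookkeeping of logarithmic factors *)

Lemma ln2_gt0 {R : realType} : 0 < ln 2 :> R.
Proof. by rewrite ln_gt0// ltr1n. Qed.

Lemma powRD_gt0 {R : realType} (x r s : R) : 0 < x ->
  x `^ (r + s) = x `^ r * x `^ s.
Proof. by move=> x0; rewrite powRD // (gt_eqF x0) implybT. Qed.

Lemma ler_ln_nat {R : realType} {m n : nat} : (0 < m)%N -> (m <= n)%N ->
  ln m%:R <= ln n%:R :> R.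
Proof.
by move=> m0 mn; rewrite ler_ln ?posrE ?ltr0n ?ler_nat// (leq_trans m0).
Qed.

(* [ln 1 = 0], so the logarithmic factor is 0 or 1 on singletons. *)
Lemma ln_factor_to_ln1D {R : realType} (C D : R) : 0 < C ->
  exists c E : R, [/\ 0 < c, 0 <= E & forall (delta : R) (b s : nat),
    (0 < b)%N -> (0 < s)%N ->
    C * b%:R `^ (1 + delta) * ln b%:R `^ D <= s%:R ->
    c * b%:R `^ (1 + delta) <= (1 + ln b%:R) `^ E * s%:R].
Proof.
move=> C0; have ln2 := @ln2_gt0 R.
have ln2_le1 : ln 2 <= 1 :> R.
  by have := @le_ln1Dx R 1; apply; rewrite (lt_trans _ ltr01)// ltrN10.
have p1 (x : R) : 1 `^ x = 1 by rewrite powR1.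
(* The bound by 1 settles [b = 1], where the claim reduces to [c <= s]. The other bound serves
   [b >= 2], where [ln b >= ln 2]. *)
exists (Num.min (C * ln 2 `^ `|D|) 1), `|D|; split=> //.
  by rewrite lt_min ltr01 mulr_gt0 ?powR_gt0.
move=> delta b s; rewrite leq_eqVlt => /orP[/eqP <-|b2] s0 hs.
  rewrite ln1 addr0 !p1 mulr1 mul1r ge_min; apply/orP; right.
  by rewrite ler1n.
have lnb : ln 2 <= ln b%:R :> R by exact: ler_ln_nat.
have lnb0 : 0 < ln b%:R :> R by apply: lt_le_trans lnb.
have lnbD : ln b%:R <= 1 + ln b%:R :> R by rewrite lerDr.
have lnbD0 : 0 < 1 + ln b%:R :> R by apply: lt_le_trans lnbD.
apply: (@le_trans _ _ (C * ln 2 `^ `|D| * b%:R `^ (1 + delta))).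
  by rewrite ler_wpM2r ?powR_ge0// ge_min lexx.
have key : ln 2 `^ `|D| <= (1 + ln b%:R) `^ `|D| * ln b%:R `^ D :> R.
  have [D0|D0] := leP 0 D.
    rewrite -[leLHS]mul1r ler_pM ?powR_ge0//.
      have := @ler_powR _ (1 + ln b%:R) _ _ _ (normr_ge0 D).
      by rewrite powRr0; apply; rewrite lerDl ltW.
    by rewrite ger0_norm// ge0_ler_powR ?nnegrE// ltW.
  have ND : 0 <= - D by rewrite ltW// oppr_gt0.
  rewrite -[in X in _ * X](opprK D) powRN ler_pdivlMr ?powR_gt0//.
  rewrite -[leRHS]mul1r ler_pM ?powR_ge0//.
    have := @ger_powR _ (ln 2) _ _ _ (normr_ge0 D); rewrite powRr0; apply.
    by rewrite ln2.
  by rewrite ltr0_norm// ge0_ler_powR ?nnegrE// ltW.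
rewrite [C * _]mulrC -mulrA.
apply: le_trans (ler_wpM2r _ key) _; first by rewrite mulr_ge0 ?powR_ge0// ltW.
by rewrite -mulrA ler_wpM2l ?powR_ge0// mulrC.
Qed.

(** Write [n^(1 + delta/d)] as [n * n^(delta/d)]. The first factor is bounded through [k * b] and
    the second through [b^delta]; together they form [k * b^(1 + delta)], which is at most [t] up to
    powers of [H]. *)
Lemma sum_product_arith {R : realType} (c E delta : R) (d : nat) :
  0 < c -> 0 <= E -> 0 < delta -> (0 < d)%N ->
  exists C D : R, 0 < C /\ forall n k b s t : nat,
    let H : R := 1 + ln n%:R in
    (0 < b <= n)%N ->
    n%:R <= (2 * H) ^+ d * (k * b)%:R ->
    n%:R <= (2 * H * b%:R) ^+ d ->
    c * b%:R `^ (1 + delta) <= (1 + ln b%:R) `^ E * s%:R ->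
    (k * s <= t)%N ->
    C * n%:R `^ (1 + delta / d%:R) * ln n%:R `^ D <= t%:R.
Proof.
move=> c0 E0 delta0 d0; have ln2 := @ln2_gt0 R.
have dR0 : 0 < d%:R :> R by rewrite ltr0n.
(* [F] is the total power of [H] lost: [d] from [k * b], [delta] from [b^delta], [E] from the
   one-dimensional bound. The constant [a] gives [H <= a * ln n] once [n >= 2]. *)
pose F : R := d%:R + delta + E; have F0 : 0 < F by rewrite /F; lra.
pose a : R := 1 + (ln 2)^-1; have a0 : 0 < a by rewrite addr_gt0// invr_gt0.
have p0 (x y : R) : 0 < x -> 0 < x `^ y by exact: powR_gt0.
exists (c / (2 `^ (d%:R + delta) * a `^ F)), (- F); split.
  by rewrite divr_gt0 ?mulr_gt0// p0.
move=> n k b s t H /andP[b0 bn] nkb nb hs kst.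
have n0 : (0 < n)%N by apply: leq_trans bn.
have H1 : 1 <= H by rewrite lerDl ln_ge0// ler1n.
have H0 : 0 < H by apply: lt_le_trans H1.
have nR0 : 0 < n%:R :> R by rewrite ltr0n.
have bR0 : 0 < b%:R :> R by rewrite ltr0n.
have [n1|n2] : n = 1%N \/ (1 < n)%N.
  by move: n0; case: (n) => [|[|m]]; [|left|right].
  (* At [n = 1] the left side vanishes, since 0 to the nonzero power [- F] is 0. *)
  by rewrite n1 ln1 powR0 ?mulr0// oppr_eq0 gt_eqF.
have HH0 : 0 < 2 * H by rewrite mulr_gt0.
have key : c * n%:R `^ (1 + delta / d%:R)
    <= 2 `^ (d%:R + delta) * H `^ F * t%:R.
  have np : n%:R `^ (delta / d%:R) <= (2 * H) `^ delta * b%:R `^ delta.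
    have bH0 : 0 < 2 * H * b%:R by rewrite mulr_gt0.
    have -> : (2 * H) `^ delta * b%:R `^ delta
        = ((2 * H * b%:R) ^+ d) `^ (delta / d%:R).
      rewrite -powRM ?ltW// -powR_mulrn ?ltW// -powRrM.
      by rewrite [d%:R * _]mulrC divfK ?gt_eqF//.
    by rewrite ge0_ler_powR ?nnegrE ?exprn_ge0 ?divr_ge0// ltW.
  rewrite [n%:R `^ _]powRD_gt0// (powRr1 (ltW nR0)).
  apply: (@le_trans _ _
    ((2 * H) `^ (d%:R + delta) * (k%:R * (c * b%:R `^ (1 + delta))))).
    have -> : (2 * H) `^ (d%:R + delta) * (k%:R * (c * b%:R `^ (1 + delta)))
        = c * (((2 * H) ^+ d * (k * b)%:R)
               * ((2 * H) `^ delta * b%:R `^ delta)).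
      rewrite !powRD_gt0// (powRr1 (ltW bR0)) powR_mulrn ?(ltW HH0)// natrM.
      ring.
    by rewrite ler_wpM2l ?ler_pM ?powR_ge0// ltW.
  have -> : 2 `^ (d%:R + delta) * H `^ F * t%:R
      = (2 * H) `^ (d%:R + delta) * (H `^ E * t%:R).
    rewrite (powRM (d%:R + delta)) ?ltW// [H `^ F]powRD_gt0//.
    ring.
  rewrite ler_wpM2l ?powR_ge0//.
  apply: (@le_trans _ _ (k%:R * (H `^ E * s%:R))).
    rewrite ler_wpM2l//; apply: le_trans hs _.
    rewrite ler_wpM2r// ge0_ler_powR ?nnegrE ?addr_ge0 ?ln_ge0 ?ler1n//.
    by rewrite lerD2l ler_ln_nat.
  by rewrite mulrCA ler_wpM2l ?powR_ge0// -natrM ler_nat.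
have lnn : ln 2 <= ln n%:R :> R by exact: ler_ln_nat.
have lnn0 : 0 < ln n%:R :> R by apply: lt_le_trans lnn.
have Hln : H <= a * ln n%:R.
  rewrite /H /a mulrDl mul1r addrC lerD2l.
  by rewrite ler_pdivlMl// mulr1.
rewrite powRN ler_pdivrMr ?p0// mulrAC ler_pdivrMr ?mulr_gt0 ?p0//.
apply: le_trans key _.
have -> : t%:R * ln n%:R `^ F * (2 `^ (d%:R + delta) * a `^ F)
   = 2 `^ (d%:R + delta) * (a * ln n%:R) `^ F * t%:R.
  rewrite (powRM F) ?ltW//; ring.
rewrite ler_wpM2r// ler_wpM2l ?powR_ge0//.
by rewrite ge0_ler_powR ?nnegrE ?mulr_ge0// ltW.
Qed.

(** * Zero patterns and the choice of a coordinate *)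

(* A class of vectors with the same zero pattern is cancellative for the
   coordinatewise product, and meets at least a 2^-d proportion of A. *)
Lemma large_cancellative_subset {d : nat} (A : {fset 'rV[RR]_d}) :
  A != fset0%fset ->
  exists A0 : {fset 'rV[RR]_d}, [/\ (A0 `<=` A)%fset,
    (#|` A| <= 2 ^ d * #|` A0|)%N &
    forall a, a \in A0 -> {in A0 &, injective (cmul a)}].
Proof.
move=> An0; pose z (a : 'rV[RR]_d) : {ffun 'I_d -> bool} :=
  [ffun i => a 0 i == 0].
have [v cardA] := pigeonhole_fiber z A An0.
exists (fiber z A v); split; first exact: fiber_sub.
  by move: cardA; rewrite card_ffun card_bool card_ord.
move=> a; rewrite in_fiber => /andP[_ /eqP za] x y.
rewrite !in_fiber => /andP[_ /eqP zx] /andP[_ /eqP zy] axy.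
apply/rowP => i; have := congr1 (fun w : 'rV[RR]_d => w 0 i) axy; rewrite !mxE.
(* Where the common pattern vanishes, [x] and [y] both have coordinate 0; elsewhere the coordinate
   of [a] is nonzero and cancels. *)
have zi (w : 'rV[RR]_d) : z w = v -> (w 0 i == 0) = v i.
  by move=> <-; rewrite ffunE.
move: (zi a za) (zi x zx) (zi y zy); case: (v i) => [_ /eqP -> /eqP ->//|].
by move=> /negbT a0 _ _; apply: mulfI.
Qed.

Lemma popular_projection {d : nat} (A : {fset 'rV[RR]_d}) :
  (0 < d)%N -> A != fset0%fset ->
  let H : RR := 1 + ln #|` A|%:R in
  exists (B : {fset RR}) (k : nat),
  [/\ (0 < #|` B| <= #|` A|)%N,
    #|` A|%:R <= (2 * H) ^+ d * (k * #|` B|)%:R,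
    #|` A|%:R <= (2 * H * #|` B|%:R) ^+ d,
    (k * #|` sumset1 B B| <= #|` sumset A A|)%N &
    (k * #|` prodset1 B B| <= #|` prodset A A|)%N].
Proof.
move=> d0 An0 H.
have [A0 [sA0 cardA0 cancA0]] := large_cancellative_subset A An0.
have A0n0 : A0 != fset0%fset.
  by apply: contraTneq cardA0 => ->; rewrite cardfs0 muln0 -ltnNge cardfs_gt0.
have n0 : (0 < #|` A0|)%N by rewrite cardfs_gt0.
have H1 : 1 <= H by rewrite lerDl ln_ge0// ler1n cardfs_gt0.
pose H' : RR := 1 + ln #|` A0|%:R.
have H'1 : 1 <= H' by rewrite lerDl ln_ge0// ler1n.
have H'H : H' <= H by rewrite lerD2l ler_ln_nat// fsubset_leq_card.
pose p (i : 'I_d) (a : 'rV[RR]_d) : RR := a 0 i.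
have [A' [sA' cardA' projA']] :=
  @popular_fibers_seq RR _ _ _ p A0 (enum 'I_d) A0n0.
rewrite -/H' size_enum_ord in cardA' projA'.
have A'n0 : A' != fset0%fset.
  by apply: contraTneq cardA' => ->; rewrite cardfs0 mul0r -ltNge ltr0n.
have [|i cardA'i] := card_le_exp_proj p A' d0 A'n0.
  by move=> x y _ _ xy; apply/rowP => i; apply: xy.
have [Ai [k [sA'i sAi kle cardAi]]] := projA' i (mem_enum _ i).
(* [A'] selects the coordinate [i], but [B] is the projection of the larger set [Ai], whose fibers
   have size at least [k]. It contains the projection of [A'], so the lower bound on its size
   carries over. *)
pose B := [fset p i x | x in Ai]%fset.
have sB : ([fset p i x | x in A'] `<=` B)%fset.
  apply/fsubsetP => _ /imfsetP[x /= xA' ->].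
  by rewrite in_imfset//; apply: (fsubsetP sA'i).
have sAiA : (Ai `<=` A)%fset by apply: fsubset_trans sA0.
(* The loss [2^d] from the zero pattern is merged with the loss [H^d] from the [d] refinements. *)
have cardA (m : nat) : #|` A0|%:R <= m%:R * H' ^+ d ->
    #|` A|%:R <= (2 * H) ^+ d * m%:R.
  move=> mH; apply: (@le_trans _ _ (2 ^+ d * #|` A0|%:R)).
    by rewrite -natrX -natrM ler_nat.
  rewrite exprMn -mulrA ler_wpM2l ?exprn_ge0//; apply: le_trans mH _.
  by rewrite mulrC ler_wpM2r// lerXn2r// nnegrE (le_trans ler01).
exists B, k; split.
- apply/andP; split.
    have /fset0Pn[x xA'] := A'n0.
    rewrite cardfs_gt0; apply/fset0Pn; exists (p i x).
    by rewrite in_imfset//; apply: (fsubsetP sA'i).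
  apply: leq_trans (fsubset_leq_card sAiA).
  exact: leq_imfset_card.
- exact: cardA.
- rewrite exprMn -natrX; apply/cardA/(le_trans cardA').
  rewrite ler_wpM2r ?exprn_ge0 ?(le_trans ler01)// ler_nat.
  by apply: leq_trans cardA'i _; rewrite leq_exp2r// fsubset_leq_card.
- apply: leq_trans (card_imfset2_ge (opT := +%R) _ _ kle) _.
  + by move=> a b; rewrite /p mxE.
  + by move=> a _ x y _ _; apply: addrI.
  + apply/fsubset_leq_card/fsubsetP => _ /imfset2P[x /= xA [y /= yA ->]].
    by rewrite in_imfset2//; apply: (fsubsetP sAiA).
- apply: leq_trans (card_imfset2_ge (opT := @cmul d) _ _ kle) _.
  + by move=> a b; rewrite /p mxE.
  + move=> a /(fsubsetP sAi) aA0 x y /(fsubsetP sAi) xA0 /(fsubsetP sAi) yA0.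
    exact: cancA0.
  + apply/fsubset_leq_card/fsubsetP => _ /imfset2P[x /= xA [y /= yA ->]].
    by rewrite in_imfset2//; apply: (fsubsetP sAiA).
Qed.

Theorem theorem1p1 (delta1 : RR) (hpos : 0 < delta1)
  (hadm : admissible_sp_exponent delta1) (d : nat) (hd : (0 < d)%N) :
  exists C D : RR, 0 < C /\
    forall A : {fset 'rV[RR]_d}, A != fset0%fset ->
      C * ((#|` A|%:R) `^ (1 + delta1 / d%:R)) * ((ln (#|` A|%:R)) `^ D)
        <= (#|` sumset A A| + #|` prodset A A|)%:R.
Proof.
have [C0 [D0 [C0_gt0 hB]]] := hadm.
have [c [E [c0 E0 hc]]] := ln_factor_to_ln1D C0 D0 C0_gt0.
have [C [D [C_gt0 hC]]] := sum_product_arith c E delta1 d c0 E0 hpos hd.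
exists C, D; split=> // A An0.
have [B [k [bn nkb nb kS kP]]] := popular_projection A hd An0.
have b0 : (0 < #|` B|)%N by case/andP: bn.
have Bn0 : B != fset0%fset by rewrite -cardfs_gt0.
apply: (hC _ k _ (#|` sumset1 B B| + #|` prodset1 B B|)%N _ bn nkb nb).
  apply: hc => //; last exact: hB.
  (* Positivity of the one-dimensional count is what the case of a singleton [B] requires. *)
  rewrite addn_gt0 cardfs_gt0; apply/orP; left.
  have /fset0Pn[x xB] := Bn0; apply/fset0Pn; exists (x + x).
  by rewrite in_imfset2.
by rewrite mulnDr leq_add.
Qed.
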